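(* Let $b>0$. Suppose that $|\langle\theta^\star,X_t\rangle|\le b$ for all $t\ge1$ and that $\psi$ is $m$-strongly convex on $[-b,b]$ with $m>0$. Let $q_1,q_2,\dots$ be the distributions played by the exponentially weighted average (EWA) forecaster with learning rate $\lambda=1/2$, and let $\widehat Y_t=\int[\langle\theta,X_t\rangle]_b\,\mathrm{d}q_{t+1}(\theta)$. Let $\delta\in(0,1)$ and, for $n\ge1$, define $$\beta_n=\frac2m\,\mathrm{regret}_{q^n,1/2}(\theta^\star)+\frac4m\log\frac1\delta,\qquad \Theta_n=\Big\{\theta\in\mathbb{R}^d:\ \frac12\sum_{t=1}^n\big(\langle\theta,X_t\rangle-\widehat Y_t\big)^2\le\beta_n\Big\}.$$ Then $\mathbb{P}[\exists n\ge1:\ \theta^\star\notin\Theta_n]\le\delta$.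
   Context: Generalized linear model (GLM). Fix $d\ge1$. Labels take values in a measurable set $\mathcal{Y}\subseteq\mathbb{R}$ equipped with a fixed $\sigma$-finite reference measure $\mathrm{d}y$ (e.g. Lebesgue or counting measure); all densities on $\mathcal{Y}$ are with respect to it. Let $h:\mathcal{Y}\to[0,\infty)$ and let $\psi:\mathbb{R}\to\mathbb{R}$ be convex and differentiable, such that for all $x,\theta\in\mathbb{R}^d$ the function $p(y|x,\theta)=\exp(\langle\theta,x\rangle y-\psi(\langle\theta,x\rangle))h(y)$ is a probability density on $\mathcal{Y}$. The data are random pairs $(X_t,Y_t)_{t\ge1}$ with $X_t\in\mathbb{R}^d$, $Y_t\in\mathcal{Y}$; let $\mathcal{F}_t=\sigma(X_1,Y_1,\dots,X_t,Y_t,X_{t+1})$ and $\mathcal{F}_0=\sigma(X_1)$. Covariates may be chosen adaptively. For a fixed unknown $\theta^\star\in\mathbb{R}^d$ and every $t\ge 1$, the conditional density of $Y_t$ given $\mathcal{F}_{t-1}$ is $p(\cdot|X_t,\theta^\star)$. Standing assumption: $\psi$ is $M$-smooth for some $M>0$, i.e. twice differentiable with $\psi''(z)\le M$ for all $z\in\mathbb{R}$. $\psi$ is $m$-strongly convex on $[-b,b]$ if $\psi''(z)\ge m$ for all $z\in[-b,b]$. $\Theta\subseteq\mathbb{R}^d$ is a measurable parameter space. Loss: $\ell_t(\theta)=-\langle\theta,X_t\rangle Y_t+\psi(\langle\theta,X_t\rangle)-\log h(Y_t)=-\log p(Y_t|X_t,\theta)$. Truncation: $[z]_b=\max\{\min\{z,b\},-b\}$.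 EWA forecaster with learning rate $\lambda>0$ and prior $q_1$ (a fixed probability distribution on $\Theta$): for $t\ge2$, $q_t$ is the probability distribution with $\frac{\mathrm{d}q_t}{\mathrm{d}q_1}(\theta)=\frac{e^{-\lambda\sum_{s=1}^{t-1}\ell_s(\theta)}}{\int e^{-\lambda\sum_{s=1}^{t-1}\ell_s}\,\mathrm{d}q_1}$ (the normalizing integrals are understood to be finite). The scaled log loss is $\mathcal{L}_{t,\lambda}(q)=-\frac1\lambda\log\int e^{-\lambda\ell_t(\theta)}\,\mathrm{d}q(\theta)$, and the scaled regret of $q^n=(q_1,\dots,q_n)$ is $\mathrm{regret}_{q^n,\lambda}(\bar\theta)=\sum_{t=1}^n(\mathcal{L}_{t,\lambda}(q_t)-\ell_t(\bar\theta))$. *)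

(* Defs.v *)
From HB Require Import structures.
From mathcomp Require Import all_boot all_order all_algebra.
From mathcomp Require Import all_classical all_reals all_analysis.
From mathcomp Require Import measurable_realfun.

Set Implicit Arguments.
Unset Strict Implicit.
Unset Printing Implicit Defensive.

Import Order.TTheory GRing.Theory Num.Theory.
Import numFieldNormedType.Exports.

Local Open Scope classical_set_scope.
Local Open Scope ring_scope.

(* Vectors of R^d are d-tuples, whose sigma-algebra is the product one. *)
Definition dotp (R : realType) (d : nat) (x y : d.-tuple R) : R :=
  \sum_(i < d) tnth x i * tnth y i.

Definition trunc (R : realType) (b z : R) : R :=
  Num.max (Num.min z b) (- b).

Definition twice_differentiable (R : realType) (psi : R -> R) : Prop :=
  forall z : R, derivable psi z 1 /\ derivable (derive1 psi) z 1.

Definition smooth (R : realType) (M : R) (psi : R -> R) : Prop :=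
  twice_differentiable psi /\ forall z : R, derive1 (derive1 psi) z <= M.

Definition strongly_convex_on (R : realType) (m b : R) (psi : R -> R) : Prop :=
  forall z : R, - b <= z <= b -> m <= derive1 (derive1 psi) z.

Definition is_density (R : realType) (mu : {measure set R -> \bar R})
    (Ydom : set R) (f : R -> R) : Prop :=
  [/\ measurable_fun Ydom f,
      forall y, Ydom y -> 0 <= f y &
      (\int[mu]_(y in Ydom) (f y)%:E = 1)%E].

Definition glm_density (R : realType) (d : nat) (psi h : R -> R)
    (x theta : d.-tuple R) (y : R) : R :=
  expR (dotp theta x * y - psi (dotp theta x)) * h y.

(* [g] is a version of the conditional probability of the event [E] given the
   sub-sigma-algebra [G]. *)
Definition is_cond_prob (R : realType) (dT : measure_display)
    (T : measurableType dT) (P : probability T R) (G : set_system T)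
    (E : set T) (g : T -> \bar R) : Prop :=
  (forall C : set (\bar R), measurable C -> G (g @^-1` C)) /\
  (forall A : set T, G A -> (P (A `&` E) = \int[P]_(w in A) g w)%E).

Definition is_cond_density (R : realType) (dT : measure_display)
    (T : measurableType dT) (P : probability T R) (G : set_system T)
    (mu : {measure set R -> \bar R}) (Ydom : set R)
    (V : T -> R) (f : T -> R -> R) : Prop :=
  (forall w, is_density mu Ydom (f w)) /\
  (forall B : set R, measurable B ->
     is_cond_prob P G (V @^-1` B)
       (fun w => \int[mu]_(y in Ydom `&` B) (f w y)%:E)%E).

(* The time index starts at 1, so the index 0 is never used: this is
   sigma(X_1, Y_1, ..., X_t, Y_t, X_{t+1}). *)
Definition history (R : realType) (dT : measure_display)
    (T : measurableType dT) (d : nat)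
    (X : nat -> T -> d.-tuple R) (Y : nat -> T -> R) (t : nat) : set_system T :=
  <<s [set A | (exists s, (1 <= s <= t.+1)%N /\
                 preimage_set_system setT (X s) measurable A) \/
               (exists s, (1 <= s <= t)%N /\
                 preimage_set_system setT (Y s) measurable A)] >>.

(* As [ln 0 = 0], the value is not meaningful when [h y = 0]; the labels of the
   model avoid this case almost surely. *)
Definition glm_loss (R : realType) (d : nat) (psi h : R -> R)
    (x : d.-tuple R) (y : R) (theta : d.-tuple R) : R :=
  - (dotp theta x * y) + psi (dotp theta x) - ln (h y).

Definition ewa_weight (R : realType) (d : nat) (lambda : R)
    (ell : nat -> d.-tuple R -> R) (t : nat) (theta : d.-tuple R) : R :=
  expR (- (lambda * \sum_(1 <= s < t) ell s theta)).

Definition ewa_normalizer (R : realType) (d : nat) (lambda : R)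
    (q1 : probability (d.-tuple R) R)
    (ell : nat -> d.-tuple R -> R) (t : nat) : \bar R :=
  (\int[q1]_theta (ewa_weight lambda ell t theta)%:E)%E.

(* [q] is the sequence of distributions played on the losses [ell]: for t >= 2
   it says that q_t has density [ewa_weight / ewa_normalizer] with respect to
   q_1, the normalizer being finite. *)
Definition is_ewa (R : realType) (d : nat) (lambda : R)
    (q1 : probability (d.-tuple R) R)
    (ell : nat -> d.-tuple R -> R)
    (q : nat -> {measure set (d.-tuple R) -> \bar R}) : Prop :=
  (forall A, measurable A -> q 1%N A = q1 A) /\
  (forall t, (2 <= t)%N ->
     (ewa_normalizer lambda q1 ell t < +oo)%E /\
     forall A, measurable A ->
       q t A = (\int[q1]_(theta in A)
         (ewa_weight lambda ell t theta /
          fine (ewa_normalizer lambda q1 ell t))%:E)%E).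

Definition scaled_log_loss (R : realType) (d : nat) (lambda : R)
    (ell_t : d.-tuple R -> R) (q : {measure set (d.-tuple R) -> \bar R}) : R :=
  - (lambda^-1 * ln (\int[q]_theta expR (- (lambda * ell_t theta)))).

Definition scaled_regret (R : realType) (d : nat) (lambda : R)
    (ell : nat -> d.-tuple R -> R)
    (q : nat -> {measure set (d.-tuple R) -> \bar R})
    (n : nat) (thetabar : d.-tuple R) : R :=
  \sum_(1 <= t < n.+1)
    (scaled_log_loss lambda (ell t) (q t) - ell t thetabar).

(* \hat Y_t, computed from x = X_t and the measure q = q_{t+1}. *)
Definition trunc_prediction (R : realType) (d : nat) (b : R) (x : d.-tuple R)
    (q : {measure set (d.-tuple R) -> \bar R}) : R :=
  \int[q]_theta trunc b (dotp theta x).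

Definition beta_radius (R : realType) (d : nat) (m delta : R)
    (ell : nat -> d.-tuple R -> R)
    (q : nat -> {measure set (d.-tuple R) -> \bar R})
    (thetastar : d.-tuple R) (n : nat) : R :=
  2 / m * scaled_regret 2^-1 ell q n thetastar + 4 / m * ln (delta^-1).

Definition confidence_set (R : realType) (d : nat) (m delta b : R)
    (x : nat -> d.-tuple R) (ell : nat -> d.-tuple R -> R)
    (q : nat -> {measure set (d.-tuple R) -> \bar R})
    (thetastar : d.-tuple R) (n : nat) : set (d.-tuple R) :=
  [set theta | 2^-1 * \sum_(1 <= t < n.+1)
                 (dotp theta (x t) - trunc_prediction b (x t) (q t.+1)) ^+ 2
               <= beta_radius m delta ell q thetastar n].

(* Main.v *)
(* With c = <thetastar, x> and a = <theta, x>, the conditional expectation of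
   exp (- (ell_t theta - ell_t thetastar) / 2) is exp (- gap), where
   gap = (psi a + psi c) / 2 - psi ((a + c) / 2) >= m / 8 * ([a]_b - c)^2: on
   [-b, b] this is strong convexity, and moving a outside [-b, b] only increases
   the gap, by convexity.  Hence multiplying the integrand by
   exp (m / 8 * ([a]_b - c)^2) keeps the conditional expectation at most 1, and
   so does averaging over q_t, which is determined by the past.  The average
   equals exp (- (L_t(q_t) - ell_t thetastar) / 2) times the q_{t+1}-average of
   exp (m / 8 * ([a]_b - c)^2), because q_{t+1} is q_t tilted by
   exp (- ell_t / 2); Jensen's inequality brings in the prediction.  The products
   of these averages are a nonnegative supermartingale bounded below by
   exp (- regret / 2 + m / 8 * sum of squares), to which Ville's inequality
   applies. *)

Require Import Defs.
From HB Require Import structures.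
From mathcomp Require Import all_boot all_order all_algebra.
From mathcomp Require Import all_classical all_reals all_analysis.
From mathcomp Require Import measurable_realfun.
From mathcomp Require Import ring lra.

Set Implicit Arguments.
Unset Strict Implicit.
Unset Printing Implicit Defensive.

Import Order.TTheory GRing.Theory Num.Theory.
Import numFieldNormedType.Exports.

Local Open Scope classical_set_scope.
Local Open Scope ring_scope.

(** * Change of measure by a density *)

Section density.
Import HBNNSimple.
Local Open Scope ereal_scope.

(** The hypothesis [nuE] is the case of indicators; linearity extends it to simple functions and
    monotone convergence to the rest. *)
Lemma ge0_integral_density d (T : measurableType d) (R : realType)
    (mu nu : {measure set T -> \bar R}) (g : T -> R)
    (g_ge0 : forall x, (0 <= g x)%R) (mg : measurable_fun setT g)
    (nuE : forall A, measurable A -> nu A = \int[mu]_(x in A) (g x)%:E)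
    (f : T -> \bar R) (f_ge0 : forall x, 0 <= f x)
    (mf : measurable_fun setT f) :
  \int[nu]_x f x = \int[mu]_x (f x * (g x)%:E).
Proof.
have mge : measurable_fun setT (EFin \o g) by exact/measurable_EFinP.
pose h := nnsfun_approx measurableT mf.
have hf x : (h n x)%:E @[n --> \oo] --> f x.
  by apply: cvg_nnsfun_approx => // y _; exact: f_ge0.
have ndh x a b : (a <= b)%N -> (h a x <= h b x)%R.
  by move=> ab; exact/lefP/nd_nnsfun_approx.
transitivity (limn (fun n => \int[nu]_x (h n x)%:E)).
  rewrite -monotone_convergence//.
  - by apply: eq_integral => x _; apply/esym/cvg_lim.
  - by move=> n; exact/measurable_EFinP.
  - by move=> n x _; rewrite lee_fin.
  - by move=> x _ a b ab; rewrite lee_fin ndh.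
transitivity (limn (fun n => \int[mu]_x ((h n x)%:E * (g x)%:E))); last first.
  rewrite -monotone_convergence//.
  - apply: eq_integral => x _; apply/cvg_lim => //.
    by apply: cvgeZr.
  - by move=> n; apply: emeasurable_funM => //; exact/measurable_EFinP.
  - by move=> n x _; rewrite mule_ge0// lee_fin.
  - by move=> x _ a b ab; rewrite lee_wpmul2r ?lee_fin ?ndh.
congr (limn _); apply/funext => n.
under eq_integral do rewrite fimfunE -fsumEFin//.
rewrite ge0_integral_fsum//; last 2 first.
- by move=> r; exact/measurable_EFinP/measurableT_comp.
- by move=> r x _; exact: nnfun_muleindic_ge0.
transitivity (\int[mu]_x (\sum_(r \in range (h n))
    ((r * \1_(h n @^-1` [set r]) x)%:E * (g x)%:E))); last first.
  apply: eq_integral => x _; rewrite fimfunE -fsumEFin// ge0_mule_fsuml// => r.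
  exact: nnfun_muleindic_ge0.
rewrite ge0_integral_fsum//; last 2 first.
- move=> r; apply: emeasurable_funM => //.
  exact/measurable_EFinP/measurableT_comp.
- by move=> r x _; rewrite mule_ge0 ?lee_fin//; exact: nnfun_muleindic_ge0.
apply: eq_fsbigr => r _.
have [r0|r0] := ltP r 0%R.
  have -> : h n @^-1` [set r] = set0 by exact: preimage_nnfun0.
  by rewrite !integral0_eq// => x _; rewrite indic0 ?mulr0 ?mule0 ?mul0e.
have mE : measurable (h n @^-1` [set r]) by exact: measurable_sfunP.
under eq_integral do rewrite EFinM.
rewrite ge0_integralZl//; last exact/measurable_EFinP.
rewrite integral_indic// setIT nuE//.
under [in RHS]eq_integral do rewrite EFinM -muleA.
rewrite ge0_integralZl//; last 2 first.
- by apply: emeasurable_funM => //; exact/measurable_EFinP.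
- by move=> x _; rewrite mule_ge0// lee_fin.
congr (_ * _); rewrite integral_mkcond; apply: eq_integral => x _.
by rewrite patchE indicE; case: ifPn => _; rewrite ?mul1e ?mul0e.
Qed.

End density.

(** * Integration against a conditional density *)

Section conditional_density.
Local Open Scope ereal_scope.

(** Gives the weighted integral the structure of a measure, so that uniqueness of measures on a
    pi-system can be applied to it. *)
Lemma ex_measure_density d (T : measurableType d) (R : realType)
    (mu : {measure set T -> \bar R}) (g : T -> \bar R)
    (g_ge0 : forall x, 0 <= g x) (mg : measurable_fun setT g) :
  exists nu : {measure set T -> \bar R},
    forall A, nu A = \int[mu]_(x in A) g x.
Proof.
pose nu A := \int[mu]_(x in A) g x.
have nu0 : nu set0 = 0 by exact: integral_set0.
have nu_ge0 A : 0 <= nu A by exact: integral_ge0.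
have nuD : semi_sigma_additive nu by exact: semi_sigma_additive_nng_induced.
pose nuM := isMeasure.Build _ _ _ nu nu0 nu_ge0 nuD.
by exists (HB.pack_for {measure set T -> \bar R} nu nuM).
Qed.

(* The law of (Z, V) and the measure of density f with respect to the product
   of the law of Z with mu agree on rectangles, hence everywhere. *)
Lemma integral_cond_density d d' (T : measurableType d) (T' : measurableType d')
    (R : realType) (P : probability T R)
    (mu : {sigma_finite_measure set R -> \bar R})
    (Z : T -> T') (V : T -> R)
    (mZ : measurable_fun setT Z) (mV : measurable_fun setT V)
    (f : T' * R -> R) (f_ge0 : forall p, (0 <= f p)%R)
    (mf : measurable_fun setT f)
    (fE : forall A B, measurable A -> measurable B ->
       P (Z @^-1` A `&` V @^-1` B) =
       \int[P]_(w in Z @^-1` A) \int[mu]_(y in B) (f (Z w, y))%:E)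
    (F : T' * R -> \bar R) (F_ge0 : forall p, 0 <= F p)
    (mF : measurable_fun setT F) :
  \int[P]_w F (Z w, V w) =
  \int[P]_w \int[mu]_y (F (Z w, y) * (f (Z w, y))%:E).
Proof.
have mfe : measurable_fun setT (EFin \o f) by exact/measurable_EFinP.
pose Zm : {mfun T >-> T'} := mfun_Sub (mem_set mZ).
pose PZ : probability T' R := distribution P Zm.
have mZV : measurable_fun setT (fun w => (Z w, V w)).
  exact: measurable_fun_pair.
pose ZV : {mfun T >-> (T' * R)%type} := mfun_Sub (mem_set mZV).
pose law : probability (T' * R)%type R := distribution P ZV.
have [dens densE] : exists nu : {measure set (T' * R) -> \bar R},
    forall A, nu A = \int[(PZ \x mu)]_(p in A) (f p)%:E.
  by apply: ex_measure_density => // p; rewrite lee_fin.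
have lawE (A : set (T' * R)) : measurable A -> law A = dens A.
  move=> mA.
  (* Rectangles form a pi-system that generates the product sigma-algebra and contains the whole
     space, on which [law] is finite. *)
  pose C : set (set (T' * R)) :=
    [set A `*` B | A in measurable & B in measurable].
  apply: (measure_unique C (fun=> setT)) => //.
  - by rewrite measurable_prod_measurableType.
  - move=> _ _ [X1 mX1 [X2 mX2 <-]] [Y1 mY1 [Y2 mY2 <-]].
    exists (X1 `&` Y1); first exact: measurableI.
    by exists (X2 `&` Y2); [exact: measurableI|rewrite setXI].
  - by move=> _; exists setT => //; exists setT => //; rewrite setXTT.
  - by rewrite bigcup_const.
  - move=> _ [A1 mA1 [A2 mA2 <-]].
    transitivity (P (Z @^-1` A1 `&` V @^-1` A2)) => //.
    (* Extending the density by 0 off the rectangle puts its integral in the form to which Tonelli's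
       theorem applies. *)
    have mr : measurable_fun setT ((fun p => (f p)%:E) \_ (A1 `*` A2)).
      apply/(measurable_restrictT _ _).1; first exact: measurableX.
      exact: measurable_funTS.
    have r_ge0 p : 0 <= ((fun p => (f p)%:E) \_ (A1 `*` A2)) p.
      by apply: erestrict_ge0 => q _; rewrite lee_fin.
    rewrite fE// densE [RHS]integral_mkcond fubini_tonelli1//.
    rewrite ge0_integral_distribution//; last 2 first.
      exact: measurable_fun_fubini_tonelli_F.
      by move=> w; apply: integral_ge0.
    rewrite [LHS]integral_mkcond; congr integral; apply/funext => w /=.
    rewrite /fubini_F patchE -[w \in _]/(Z w \in A1); case: ifPn => wA.
      rewrite [LHS]integral_mkcond; congr integral; apply/funext => y.
      by rewrite !patchE in_setX/= wA.
    by rewrite integral0_eq// => y _; rewrite patchE in_setX/= (negbTE wA).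
  - move=> _; rewrite -ge0_fin_numE//; exact: fin_num_measure.
transitivity (\int[law]_p F p).
  by rewrite ge0_integral_pushforward.
rewrite (@ge0_integral_density _ _ _ (PZ \x mu) law f)//; last first.
  by move=> A mA; rewrite -densE; exact: lawE.
have mFf : measurable_fun setT (fun p => F p * (f p)%:E).
  exact: emeasurable_funM.
have Ff_ge0 p : 0 <= F p * (f p)%:E by rewrite mule_ge0 ?lee_fin.
rewrite fubini_tonelli1//.
rewrite ge0_integral_distribution//.
  exact: measurable_fun_fubini_tonelli_F.
by move=> w; apply: integral_ge0.
Qed.

End conditional_density.

(** * Ville's maximal inequality *)

Section ville.
Local Open Scope ereal_scope.

(* The integral of N n over [B n] (no value above c so far) plus c times the
   probability of its complement never increases: paths leave [B n] with a value
   above c. *)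
Lemma ville_inequality d (T : measurableType d) (R : realType)
    (P : probability T R) (N : nat -> T -> \bar R) (c : R) (c_gt0 : (0 < c)%R)
    (N_ge0 : forall n w, 0 <= N n w)
    (mN : forall n, measurable_fun setT (N n))
    (N0 : forall w, N 0%N w = 1)
    (N_super : forall n,
       \int[P]_(w in [set w | forall k, (k <= n)%N -> N k w <= c%:E]) N n.+1 w <=
       \int[P]_(w in [set w | forall k, (k <= n)%N -> N k w <= c%:E]) N n w) :
  P [set w | exists n, c%:E < N n w] <= c^-1%:E.
Proof.
pose B n := [set w | forall k, (k <= n)%N -> N k w <= c%:E].
have mle k : measurable [set w | N k w <= c%:E].
  by rewrite -[X in measurable X]setTI; exact: emeasurable_fun_infty_c.
have BE n : B n = \bigcap_(k in [set k | (k <= n)%N]) [set w | N k w <= c%:E].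
  by apply/seteqP; split => w Bw k /=; exact: Bw.
have mB n : measurable (B n).
  rewrite BE; apply: bigcap_measurable => //; exists 0%N => //.
have BS n : B n.+1 = B n `&` [set w | N n.+1 w <= c%:E].
  apply/seteqP; split=> [w Bw|w [Bw Nw] k /=].
    by split => [k kn|]; apply: Bw => //=; rewrite ltnW.
  by rewrite leq_eqVlt => /predU1P[->//|]; rewrite ltnS; exact: Bw.
have step n : \int[P]_(w in B n) N n w + c%:E * P (~` B n) <= 1.
  elim: n => [|n IH].
    (* As the process starts at 1, [B 0] is everything when c is at least 1; otherwise it is empty
       and the left side is at most c, hence at most 1. *)
    have [c1|c1] := leP 1%R c.
      have -> : B 0%N = setT.
        apply/seteqP; split => // w _ k; rewrite leqn0 => /eqP ->.
        by rewrite N0 lee_fin.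
      rewrite setCT measure0 mule0 adde0.
      rewrite (eq_integral (cst 1)) => [|w _]; last exact: N0.
      by rewrite integral_cst// mul1e probability_le1.
    have -> : B 0%N = set0.
      apply/seteqP; split => // w /(_ 0%N (leqnn _)).
      by rewrite N0 lee_fin => /(lt_le_trans c1); rewrite ltxx.
    rewrite integral_set0 setC0 add0e.
    have cP : c%:E * P setT <= c%:E * 1.
      by rewrite lee_wpmul2l ?probability_le1// lee_fin ltW.
    by rewrite (le_trans cP)// mule1 lee_fin ltW.
  apply: le_trans IH.
  have mD : measurable (B n `\` B n.+1) by exact: measurableD.
  have -> : ~` B n.+1 = ~` B n `|` (B n `\` B n.+1).
    rewrite BS; apply/seteqP; split => w /=; have [] := pselect (B n w); tauto.
  rewrite measureU//; last 2 first.
  - exact: measurableC.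
  - by apply/seteqP; split => w //= -[? []].
  rewrite ge0_muleDr// addeCA [leRHS]addeC leeD2l//.
  rewrite (le_trans _ (N_super n))// -/(B n).
  (* On the paths of [B n] that leave at time n+1, [N n.+1] exceeds c, which pays for c times their
     probability. *)
  have {2}-> : B n = B n.+1 `|` (B n `\` B n.+1).
    rewrite BS; apply/seteqP; split => w /=;
      have [] := pselect (N n.+1 w <= c%:E); tauto.
  rewrite ge0_integral_setU//; last 2 first.
  - exact: measurable_funTS.
  - by rewrite disj_set2E; apply/eqP/seteqP; split => w //= -[? []].
  rewrite leeD2l// -integral_cst//.
  apply: ge0_le_integral => //.
  - by move=> w _; rewrite lee_fin ltW.
  - exact: measurable_funTS.
  by move=> w []; rewrite BS => Bw /not_andP[//|/negP]; rewrite -ltNge => /ltW.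
have PB n : P (~` B n) <= c^-1%:E.
  rewrite -(@lee_pmul2l _ c%:E)// -EFinM divff ?gt_eqF//.
  apply: le_trans (step n); rewrite leeDr//; exact: integral_ge0.
(* The crossing event is the increasing union of the complements of [B n], so continuity from below
   transfers the uniform bound. *)
have -> : [set w | exists n, c%:E < N n w] = \bigcup_n ~` B n.
  apply/seteqP; split => w /=.
    move=> [n cN]; exists n => //= /(_ n (leqnn n)).
    by rewrite leNgt => /negP; exact.
  by move=> [n _ /existsNP[k /not_implyP[_ /negP]]]; rewrite -ltNge; exists k.
have ndB : nondecreasing_seq (fun n => ~` B n).
  move=> i j ij; apply/subsetPset/subsetC => w Bw k ki.
  by apply: Bw; exact: leq_trans ij.
have mBC n : measurable (~` B n) by exact: measurableC.
have := nondecreasing_cvg_mu mBC (bigcup_measurable (fun n _ => mBC n)) ndB.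
move=> /(_ _ P) cP; rewrite -(cvg_lim _ cP)//.
apply: lime_le; first by apply/cvg_ex; eexists; exact: cP.
by apply: nearW.
Qed.

End ville.

(** * Midpoint Jensen gaps of convex and strongly convex functions *)

Section convexity.
Variable R : realType.
Implicit Types (psi : R -> R).

Lemma convex_functionT_le psi (t x y : R) : convex_function [set: R^o] psi ->
  0 <= t <= 1 -> psi (t * x + (1 - t) * y) <= t * psi x + (1 - t) * psi y.
Proof.
move=> cpsi /andP[t0 t1].
exact: (cpsi (Itv01 t0 t1) x y (mem_set I) (mem_set I)).
Qed.

(* Both b and (a + c) / 2 lie between (b + c) / 2 and a; add up the two convexity
   inequalities. *)
Lemma convex_gap_mono psi (a b c : R) : convex_function [set: R^o] psi ->
  c <= b <= a \/ a <= b <= c ->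
  (psi b + psi c) / 2 - psi ((b + c) / 2) <=
  (psi a + psi c) / 2 - psi ((a + c) / 2).
Proof.
move=> cpsi cba.
have [->//|ab] := eqVneq a b.
(* The weight t solves [t * a + (1 - t) * u = (a + c) / 2]; it then also satisfies
   [2 * t * u + (1 - 2 * t) * a = b]. *)
pose u := (b + c) / 2; pose t := (a - b) / 2 / (a - u).
have au : a - u != 0.
  by apply: contra_neq ab; rewrite /u; case: cba => /andP[]; lra.
have ht : 0 <= 2 * t <= 1.
  have -> : 2 * t = (a - b) / (a - u) by rewrite /t; field.
  case: cba => /andP[h1 h2].
    have au0 : 0 < a - u by rewrite lt_def au /u; lra.
    rewrite divr_ge0 ?(ltW au0) ?subr_ge0//= ler_pdivrMr// mul1r /u; lra.
  have au0 : 0 < u - a by rewrite lt_def subr_eq0 eq_sym -subr_eq0 au /u; lra.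
  rewrite -(opprB b a) -(opprB u a) invrN mulrNN.
  rewrite divr_ge0 ?(ltW au0) ?subr_ge0//= ler_pdivrMr// mul1r /u; lra.
have tau : t * (a - u) = (a - b) / 2 by rewrite /t divfK.
have h1 := @convex_functionT_le psi t a u cpsi.
have h2 := @convex_functionT_le psi (2 * t) u a cpsi ht.
have e1 : t * a + (1 - t) * u = (a + c) / 2.
  by rewrite mulrBl mul1r addrCA -mulrBr tau /u; lra.
have e2 : 2 * t * u + (1 - 2 * t) * a = b.
  have -> : 2 * t * u + (1 - 2 * t) * a = a - 2 * (t * (a - u)) by ring.
  by rewrite tau; lra.
rewrite e1 in h1; rewrite e2 in h2; rewrite -/u.
have {}h1 := h1 (ltac:(lra)).
(* The first inequality plus half of the second: the terms in t cancel. *)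
lra.
Qed.

(** Subtracting [m / 2 * z ^+ 2] from [psi] leaves a function with nonnegative second derivative on
    [-b, b], hence convex there; the midpoint gap of the quadratic itself is
    [m / 8 * (x - y) ^+ 2]. *)
Lemma strongly_convex_gap psi (m b x y : R) : twice_differentiable psi ->
  strongly_convex_on m b psi -> - b <= x <= b -> - b <= y <= b ->
  m / 8 * (x - y) ^+ 2 <= (psi x + psi y) / 2 - psi ((x + y) / 2).
Proof.
move=> dpsi spsi xb yb; wlog xy : x y xb yb / x <= y.
  move=> h; have [|/ltW yx] := leP x y; first exact: h.
  have -> : (x - y) ^+ 2 = (y - x) ^+ 2 by ring.
  by rewrite (addrC x) (addrC (psi x)); exact: h.
pose f (z : R) : R := psi z - m / 2 * z ^+ 2.
have Df (z : R) : is_derive z 1 f (derive1 psi z - m * z).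
  have dz : is_derive z 1 psi (derive1 psi z).
    by rewrite derive1E; exact/derivableP/(dpsi z).1.
  by rewrite /f; apply: is_derive_eq; rewrite /GRing.scale/=; field.
have DfE : 'D_1 f = fun z => derive1 psi z - m * z.
  by apply/funext => v; have := Df v => -[_ ->].
have DDf (z : R) : is_derive z 1 ('D_1 f) (derive1 (derive1 psi) z - m).
  have dz : is_derive z 1 (derive1 psi) (derive1 (derive1 psi) z).
    by rewrite [X in is_derive _ _ _ X]derive1E; exact/derivableP/(dpsi z).2.
  by rewrite DfE; apply: is_derive_eq; rewrite /GRing.scale/=; ring.
have cf z : {for z, continuous f}.
  by apply: differentiable_continuous; apply/derivable1_diffP; exact: ex_derive.
have h01 : 0 <= (2^-1 : R) /\ (2^-1 : R) <= 1 by split; lra.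
have fconv : f (2^-1 * x + (1 - 2^-1) * y) <= 2^-1 * f x + (1 - 2^-1) * f y.
  apply: (@second_derivative_convex R f x y _ _ _ _ _ (Itv01 h01.1 h01.2) xy).
  - move=> z /andP[xz zy]; have [_ ->] := DDf z.
    by rewrite subr_ge0; apply: spsi; apply/andP; split; lra.
  - exact/cvg_at_left_filter/cf.
  - exact/cvg_at_right_filter/cf.
  - by move=> z _; exact: ex_derive.
  - by move=> z _; have [] := DDf z.
have -> : (x + y) / 2 = 2^-1 * x + (1 - 2^-1) * y by lra.
rewrite /f in fconv.
set p := psi (_ + _) in fconv *.
have -> : (x - y) ^+ 2 = 2 * x ^+ 2 + 2 * y ^+ 2 - (x + y) ^+ 2 by ring.
have e : 2^-1 * x + (1 - 2^-1) * y = (x + y) / 2 by lra.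
rewrite e in fconv; nra.
Qed.

Lemma trunc_itv (b z : R) : 0 < b -> - b <= trunc b z <= b.
Proof. by move=> b0; rewrite /trunc le_max lexx orbT/= ge_max ge_min lexx orbT/=; lra. Qed.

(** Since c belongs to [-b, b], the truncation of a lies between c and a, so replacing it by a can
    only widen the gap given by strong convexity. *)
Lemma trunc_gap psi (m b a c : R) : 0 < b -> convex_function [set: R^o] psi ->
  twice_differentiable psi -> strongly_convex_on m b psi -> - b <= c <= b ->
  m / 8 * (trunc b a - c) ^+ 2 <= (psi a + psi c) / 2 - psi ((a + c) / 2).
Proof.
move=> b0 cpsi dpsi spsi cb.
apply: le_trans (strongly_convex_gap dpsi spsi (trunc_itv _ b0) cb) _.
apply: convex_gap_mono => //; move/andP: cb => [cb1 cb2].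
rewrite /trunc; have [ab|ab] := leP a b; have [ab'|ab'] := leP (- b) _; lra.
Qed.

End convexity.

(** * Measurability of the model quantities *)

Section glm_measurability.
Context d0 (S : measurableType d0) (R : realType) (d : nat).
Variables (Ydom : set R) (psi h : R -> R).
Hypotheses (mYdom : measurable Ydom) (mh : measurable_fun Ydom h)
  (mpsi : measurable_fun setT psi).
Implicit Types (x theta : S -> d.-tuple R) (y : S -> R).

Lemma measurable_dotp x theta : measurable_fun setT x ->
  measurable_fun setT theta ->
  measurable_fun setT (fun s => dotp (theta s) (x s)).
Proof.
move=> mx mtheta; apply: measurable_sum => i; apply: measurable_funM.
  exact: (measurableT_comp (measurable_tnth i)).
exact: (measurableT_comp (measurable_tnth i)).
Qed.

Lemma measurable_trunc b (f : S -> R) : measurable_fun setT f ->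
  measurable_fun setT (fun s => trunc b (f s)).
Proof. by move=> mf; apply: measurable_maxr => //; exact: measurable_minr. Qed.

Lemma measurable_in_comp y : measurable_fun setT y ->
  (forall s, Ydom (y s)) -> measurable_fun setT (fun s => h (y s)).
Proof.
move=> my yY; apply: (measurable_comp mYdom _ mh my).
by move=> _ [s _ <-]; exact: yY.
Qed.

Lemma measurable_glm_loss x y theta : measurable_fun setT x ->
  measurable_fun setT y -> (forall s, Ydom (y s)) ->
  measurable_fun setT theta ->
  measurable_fun setT (fun s => glm_loss psi h (x s) (y s) (theta s)).
Proof.
move=> mx my yY mtheta; have md := measurable_dotp mx mtheta.
apply: measurable_funB; last first.
  by apply: measurableT_comp => //; exact: measurable_in_comp.
apply: measurable_funD; last exact: measurableT_comp.
by apply: measurableT_comp => //; exact: measurable_funM.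
Qed.

Lemma measurable_ewa_weight lambda (xs : nat -> S -> d.-tuple R)
    (ys : nat -> S -> R) t theta :
  (forall s, (1 <= s < t)%N -> measurable_fun setT (xs s)) ->
  (forall s, (1 <= s < t)%N -> measurable_fun setT (ys s)) ->
  (forall s w, (1 <= s)%N -> Ydom (ys s w)) ->
  measurable_fun setT theta ->
  measurable_fun setT (fun w =>
    ewa_weight lambda (fun s => glm_loss psi h (xs s w) (ys s w)) t (theta w)).
Proof.
move=> mx my yY mtheta; apply: measurableT_comp => //.
apply: measurableT_comp => //; apply: measurable_funM; first exact: measurable_cst.
(* The guard makes every summand measurable, whereas the hypotheses on [xs] and [ys] cover only
   indices in range. *)
rewrite (_ : (fun _ => _) = (fun w => \sum_(1 <= s < t)
  if (1 <= s < t)%N then glm_loss psi h (xs s w) (ys s w) (theta w) else 0)).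
  apply: measurable_sum => s; case st : (1 <= s < t)%N => //=.
  apply: measurable_glm_loss; [exact: mx|exact: my| |exact: mtheta].
  by move=> w; apply: yY; case/andP: st.
by apply/funext => w; rewrite !big_nat; apply: eq_bigr => s st; rewrite st.
Qed.

(** The extension by 0 off [Ydom] is part of the function because measurability of [h] is known only
    on [Ydom]. *)
Lemma measurable_glm_density x y theta : measurable_fun setT x ->
  measurable_fun setT y -> measurable_fun setT theta ->
  measurable_fun setT (fun s => (glm_density psi h (x s) (theta s) \_ Ydom) (y s)).
Proof.
move=> mx my mtheta; have md := measurable_dotp mx mtheta.
have mhY : measurable_fun setT (h \_ Ydom) by exact/(measurable_restrictT _ _).1.
rewrite (_ : (fun _ => _) = (fun s => expR (dotp (theta s) (x s) * y s -
    psi (dotp (theta s) (x s))) * (h \_ Ydom) (y s))).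
  apply: measurable_funM; last exact: measurableT_comp.
  apply: measurableT_comp => //; apply: measurable_funB.
    exact: measurable_funM.
  exact: measurableT_comp.
by apply/funext => s; rewrite !patchE; case: ifP => // _; rewrite mulr0.
Qed.

End glm_measurability.

(** * The tilted likelihood ratio and its conditional mean *)

Section tilt.
Context (R : realType) (d : nat).
Variables (Ydom : set R) (mu : {sigma_finite_measure set R -> \bar R}).
Variables (psi h : R -> R) (m b : R) (thetastar : d.-tuple R).
Implicit Types x theta : d.-tuple R.

(** The square root of the likelihood ratio of [theta] to [thetastar], in which [h] cancels, times
    the exponential reward for the squared error of the truncated prediction. *)
Definition tilt x y theta : R :=
  expR (((dotp theta x - dotp thetastar x) * y
           - psi (dotp theta x) + psi (dotp thetastar x)) / 2
        + m / 8 * (trunc b (dotp theta x) - dotp thetastar x) ^+ 2).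

Lemma measurable_tilt d0 (S : measurableType d0) (x theta : S -> d.-tuple R)
    (y : S -> R) : measurable_fun setT psi ->
  measurable_fun setT x -> measurable_fun setT y -> measurable_fun setT theta ->
  measurable_fun setT (fun s => tilt (x s) (y s) (theta s)).
Proof.
move=> mpsi mx my mtheta.
have ma : measurable_fun setT (fun s => dotp (theta s) (x s)).
  exact: measurable_dotp.
have ms : measurable_fun setT (fun s => dotp thetastar (x s)).
  by apply: measurable_dotp.
apply: measurableT_comp => //; apply: measurable_funD.
  apply: measurable_funM => //; apply: measurable_funD.
    apply: measurable_funB; last exact: measurableT_comp.
    by apply: measurable_funM => //; exact: measurable_funB.
  exact: measurableT_comp.
apply: measurable_funM => //; apply: measurable_funX; apply: measurable_funB => //.
exact: measurable_trunc.
Qed.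

Hypothesis mYdom : measurable Ydom.
Hypothesis p_density : forall x theta,
  is_density mu Ydom (glm_density psi h x theta).

(** At x = theta = 0 the model density is [h] up to the constant factor [expR (- psi 0)]. *)
Lemma measurable_base_density : measurable_fun Ydom h.
Proof.
pose o : d.-tuple R := [tuple 0 | i < d].
have [mp _ _] := p_density o o.
rewrite (_ : h = fun y => expR (psi 0) * glm_density psi h o o y).
  exact: measurable_funM.
apply/funext => y; rewrite /glm_density.
have -> : dotp o o = 0.
  by rewrite /dotp big1// => i _; rewrite tnth_mktuple mul0r.
by rewrite mul0r sub0r mulrA -expRD subrr expR0 mul1r.
Qed.

Lemma dotp_midpoint x theta :
  dotp [tuple (tnth theta i + tnth thetastar i) / 2 | i < d] x =
  (dotp theta x + dotp thetastar x) / 2.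
Proof.
rewrite /dotp -big_split/= mulr_suml; apply: eq_bigr => i _.
by rewrite tnth_mktuple -mulrDl mulrAC.
Qed.

Hypotheses (b_gt0 : 0 < b) (cpsi : convex_function [set: R^o] psi)
  (dpsi : twice_differentiable psi) (spsi : strongly_convex_on m b psi).

(* The Bhattacharyya affinity of two members of the exponential family is
   governed by the Jensen gap of [psi]. *)
Lemma integral_tilt_le1 x theta : `|dotp thetastar x| <= b ->
  (\int[mu]_(y in Ydom)
     (tilt x y theta * glm_density psi h x thetastar y)%:E <= 1)%E.
Proof.
rewrite ler_norml => xb.
set a := dotp theta x; set c := dotp thetastar x in xb *.
(* The geometric mean of the two densities is proportional to the density at the midpoint parameter;
   the exponent of [k] is the quadratic reward minus the Jensen gap. *)
pose k := expR (m / 8 * (trunc b a - c) ^+ 2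
                - ((psi a + psi c) / 2 - psi ((a + c) / 2))).
have [mmid mid_ge0 mid1] :=
  p_density x [tuple (tnth theta i + tnth thetastar i) / 2 | i < d].
rewrite (eq_integral (fun y => k%:E * (glm_density psi h x
    [tuple (tnth theta i + tnth thetastar i) / 2 | i < d] y)%:E)%E); last first.
  move=> y _; rewrite -EFinM; congr EFin.
  rewrite /tilt /glm_density /k dotp_midpoint -/a -/c [LHS]mulrA [RHS]mulrA -!expRD.
  by congr (expR _ * _); field.
rewrite ge0_integralZl//; last 2 first.
- exact/measurable_EFinP.
- by rewrite lee_fin expR_ge0.
rewrite mid1 mule1 lee_fin /k -[leRHS]expR0 ler_expR subr_le0.
exact: trunc_gap.
Qed.

Local Open Scope ereal_scope.

(** Tonelli's theorem lets the label be integrated first, where [integral_tilt_le1] gives at most 1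
    for each [theta]; what remains is the mass of [u]. Here [u] stands for the density of q_t with
    respect to q_1. *)
Lemma integral_mixture_le1 (q1 : probability (d.-tuple R) R)
    (u : d.-tuple R -> R) x :
  measurable_fun setT psi ->
  (forall theta, (0 <= u theta)%R) -> measurable_fun setT u ->
  \int[q1]_theta (u theta)%:E <= 1 ->
  (`|dotp thetastar x| <= b)%R ->
  \int[mu]_y ((\int[q1]_theta (u theta * tilt x y theta)%:E) *
              ((glm_density psi h x thetastar \_ Ydom) y)%:E) <= 1.
Proof.
move=> mpsi u_ge0 mu1 u1 xb.
pose p := glm_density psi h x thetastar \_ Ydom.
have p_ge0 y : (0 <= p y)%R.
  rewrite /p patchE; case: ifPn => // /set_mem yY.
  by have [_ + _] := p_density x thetastar; exact.
have mp : measurable_fun setT p.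
  by have [+ _ _] := p_density x thetastar; move/(measurable_restrictT _ _).1; exact.
have mtl : measurable_fun setT
    (fun z : R * d.-tuple R => (u z.2 * tilt x z.1 z.2)%R).
  apply: measurable_funM; first exact: measurableT_comp.
  by apply: measurable_tilt.
rewrite (eq_integral (fun y =>
    \int[q1]_theta ((u theta * tilt x y theta) * p y)%:E)); last first.
  move=> y _; under [RHS]eq_integral do rewrite EFinM.
  rewrite ge0_integralZr//.
  - apply/measurable_EFinP/measurable_funM => //.
    by apply: measurable_tilt.
  - by move=> theta _; rewrite lee_fin mulr_ge0 ?expR_ge0.
  - by rewrite lee_fin.
have mf : measurable_fun setT (fun z : R * d.-tuple R =>
    ((u z.2 * tilt x z.1 z.2) * p z.1)%:E).
  apply/measurable_EFinP/measurable_funM => //.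
  exact: measurableT_comp.
rewrite (fubini_tonelli (fun z : R * d.-tuple R =>
    ((u z.2 * tilt x z.1 z.2) * p z.1)%:E))//; last first.
  by move=> z; rewrite lee_fin !mulr_ge0 ?expR_ge0.
apply: le_trans u1; apply: ge0_le_integral => //.
- move=> theta _; apply: integral_ge0 => y _.
  by rewrite lee_fin !mulr_ge0 ?expR_ge0.
- apply: (measurable_fun_fubini_tonelli_G (fun z : R * d.-tuple R =>
    ((u z.2 * tilt x z.1 z.2) * p z.1)%:E)) => //.
  by move=> z; rewrite lee_fin !mulr_ge0 ?expR_ge0.
- exact/measurable_EFinP.
move=> theta _ /=.
under eq_integral do rewrite -mulrA EFinM.
rewrite ge0_integralZl//; last 3 first.
- apply/measurable_EFinP/measurable_funM => //.
  by apply: measurable_tilt.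
- by move=> y _; rewrite lee_fin mulr_ge0 ?expR_ge0.
- by rewrite lee_fin.
rewrite -[leRHS]mule1 lee_wpmul2l ?lee_fin//.
apply: le_trans (integral_tilt_le1 theta xb).
rewrite [leRHS]integral_mkcond le_eqVlt; apply/orP; left; apply/eqP.
by apply: eq_integral => y _; rewrite /p !patchE; case: ifP => // _; rewrite mulr0.
Qed.

End tilt.

(** * The mixture gains and their product *)

Section mixture_process.
Context (R : realType) (d : nat).
Variables (Ydom : set R) (psi h : R -> R) (m b : R) (thetastar : d.-tuple R).
Variable (q1 : probability (d.-tuple R) R).
Implicit Types (ell : nat -> d.-tuple R -> R) (theta : d.-tuple R).
Local Open Scope ereal_scope.

(* Identically 0 when the normalizer is infinite, as [fine +oo = 0]. *)
Definition ewa_density ell t theta : R :=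
  ewa_weight 2^-1 ell t theta / fine (ewa_normalizer 2^-1 q1 ell t).

Lemma ewa_normalizer_ge0 ell t : 0 <= ewa_normalizer 2^-1 q1 ell t.
Proof. by apply: integral_ge0 => theta _; rewrite lee_fin expR_ge0. Qed.

Lemma ewa_density_ge0 ell t theta : (0 <= ewa_density ell t theta)%R.
Proof. by rewrite divr_ge0 ?expR_ge0// fine_ge0// ewa_normalizer_ge0. Qed.

(** A finite nonzero normalizer gives mass 1, while the values 0 and infinity give mass 0; hence
    only an inequality. *)
Lemma integral_ewa_density_le1 ell t :
  measurable_fun setT (ewa_weight 2^-1 ell t) ->
  \int[q1]_theta (ewa_density ell t theta)%:E <= 1.
Proof.
move=> mw; rewrite /ewa_density; set Z := ewa_normalizer _ _ _ _.
have Z_ge0 : 0 <= Z by exact: ewa_normalizer_ge0.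
under eq_integral do rewrite EFinM.
rewrite ge0_integralZr//; last 3 first.
- exact/measurable_EFinP.
- by move=> theta _; rewrite lee_fin expR_ge0.
- by rewrite lee_fin invr_ge0 fine_ge0.
rewrite -/(ewa_normalizer _ _ _ _) -/Z.
move: Z_ge0; case: Z => [z| |]//=.
- rewrite lee_fin => z0; rewrite -EFinM lee_fin.
  have [->|z1] := eqVneq z 0%R; first by rewrite mul0r.
  by rewrite divff.
- by rewrite invr0 mule0.
Qed.

(** The current label is a separate argument, so that it can be integrated out with the past held
    fixed; the density at time t reads [ys s] only for s < t. *)
Definition mix_gain (xs : nat -> d.-tuple R) (ys : nat -> R) t (y : R) :=
  \int[q1]_theta (ewa_density (fun s => glm_loss psi h (xs s) (ys s)) t theta *
                  tilt psi m b thetastar (xs t) y theta)%:E.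

Fixpoint mix_prod (xs : nat -> d.-tuple R) (ys : nat -> R) n : \bar R :=
  if n is k.+1 then mix_prod xs ys k * mix_gain xs ys k.+1 (ys k.+1) else 1.

Lemma mix_gain_ge0 xs ys t y : 0 <= mix_gain xs ys t y.
Proof.
apply: integral_ge0 => theta _.
by rewrite lee_fin mulr_ge0 ?ewa_density_ge0 ?expR_ge0.
Qed.

Lemma mix_prod_ge0 xs ys n : 0 <= mix_prod xs ys n.
Proof. by elim: n => //= n ih; rewrite mule_ge0 ?mix_gain_ge0. Qed.

Hypotheses (mYdom : measurable Ydom) (mh : measurable_fun Ydom h)
  (mpsi : measurable_fun setT psi).

Section measurability.
Context d0 (S : measurableType d0).
Variables (xs : nat -> S -> d.-tuple R) (ys : nat -> S -> R).
Hypothesis yY : forall s w, (1 <= s)%N -> Ydom (ys s w).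

Lemma measurable_ewa_density t :
  (forall s, (1 <= s < t)%N -> measurable_fun setT (xs s)) ->
  (forall s, (1 <= s < t)%N -> measurable_fun setT (ys s)) ->
  measurable_fun setT (fun p : S * d.-tuple R =>
    ewa_density (fun s => glm_loss psi h (xs s p.1) (ys s p.1)) t p.2).
Proof.
move=> mx my.
have mw : measurable_fun setT (fun p : S * d.-tuple R =>
    ewa_weight 2^-1 (fun s => glm_loss psi h (xs s p.1) (ys s p.1)) t p.2).
  apply: (@measurable_ewa_weight _ _ _ _ Ydom psi h mYdom mh mpsi _
    (fun s p => xs s p.1) (fun s p => ys s p.1)) => //.
  - by move=> s st; apply: measurableT_comp => //; exact: mx.
  - by move=> s st; apply: measurableT_comp => //; exact: my.
  - by move=> s w s1; exact: yY.
apply: measurable_funM => //.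
(* The inverse is written as a power with exponent -1, whose measurability is available; the two
   agree on nonnegative reals. *)
rewrite (_ : (fun _ => _) = fun p : S * d.-tuple R => (fine (ewa_normalizer 2^-1
    q1 (fun s => glm_loss psi h (xs s p.1) (ys s p.1)) t) `^ (-1))%R); last first.
  by apply/funext => p; rewrite powR_inv1// fine_ge0// ewa_normalizer_ge0.
apply: (measurableT_comp (measurable_powR (-1)%R)).
apply: (measurableT_comp (fine_measurable measurableT)).
apply: (measurableT_comp (f := fun w => ewa_normalizer 2^-1 q1
  (fun s => glm_loss psi h (xs s w) (ys s w)) t)) => //.
apply: (measurable_fun_fubini_tonelli_F (fun p : S * d.-tuple R =>
  (ewa_weight 2^-1 (fun s => glm_loss psi h (xs s p.1) (ys s p.1)) t p.2)%:E)).
  exact/measurable_EFinP.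
by move=> p; rewrite lee_fin expR_ge0.
Qed.

(** Covariates enter up to time t but labels only before t: as a function of a fresh label, the gain
    is determined by F_{t-1}. *)
Lemma measurable_mix_gain t : (0 < t)%N ->
  (forall s, (1 <= s <= t)%N -> measurable_fun setT (xs s)) ->
  (forall s, (1 <= s < t)%N -> measurable_fun setT (ys s)) ->
  measurable_fun setT (fun p : S * R =>
    mix_gain (xs ^~ p.1) (ys ^~ p.1) t p.2).
Proof.
move=> t0 mx my.
have mx' s : (1 <= s < t)%N -> measurable_fun setT (xs s).
  by move=> /andP[s1 st]; apply: mx; rewrite s1 ltnW.
apply: (measurable_fun_fubini_tonelli_F (fun p : (S * R) * d.-tuple R =>
  (ewa_density (fun s => glm_loss psi h (xs s p.1.1) (ys s p.1.1)) t p.2 *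
   tilt psi m b thetastar (xs t p.1.1) p.1.2 p.2)%:E)).
  apply/measurable_EFinP/measurable_funM.
    apply: (measurableT_comp (measurable_ewa_density mx' my)
      (g := fun p : (S * R) * d.-tuple R => (p.1.1, p.2))).
    apply: measurable_fun_pair => //; exact: measurableT_comp.
  apply: measurable_tilt => //.
    by do 2 apply: measurableT_comp => //; apply: mx; rewrite t0/=.
  exact: measurableT_comp.
by move=> p; rewrite lee_fin mulr_ge0 ?ewa_density_ge0 ?expR_ge0.
Qed.

Lemma measurable_mix_prod n :
  (forall s, (1 <= s <= n)%N -> measurable_fun setT (xs s)) ->
  (forall s, (1 <= s <= n)%N -> measurable_fun setT (ys s)) ->
  measurable_fun setT (fun w => mix_prod (xs ^~ w) (ys ^~ w) n).
Proof.
elim: n => [|n ih] mx my //=.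
apply: emeasurable_funM.
  by apply: ih => s /andP[s1 sn]; [apply: mx|apply: my]; rewrite s1 ltnW.
apply: (measurableT_comp (f := fun p : S * R =>
  mix_gain (xs ^~ p.1) (ys ^~ p.1) n.+1 p.2) (g := fun w => (w, ys n.+1 w))).
  apply: measurable_mix_gain => // s /andP[s1 sn]; apply: my.
  by rewrite s1 ltnW.
by apply: measurable_fun_pair => //; apply: my; rewrite ltnS leqnn.
Qed.

End measurability.

End mixture_process.

(** * The supermartingale property along the filtration of the data *)

Section supermartingale.
Context (R : realType) (dT : measure_display) (T : measurableType dT)
  (P : probability T R) (d : nat).
Variables (Ydom : set R) (mYdom : measurable Ydom)
  (mu : {sigma_finite_measure set R -> \bar R}).
Variables (psi h : R -> R)
  (cpsi : convex_function [set: R^o] psi) (dpsi : twice_differentiable psi)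
  (mpsi : measurable_fun setT psi)
  (p_density : forall x theta : d.-tuple R,
     is_density mu Ydom (glm_density psi h x theta)).
Variables (X : nat -> T -> d.-tuple R) (Y : nat -> T -> R).
Hypotheses (mX : forall t, (1 <= t)%N -> measurable_fun setT (X t))
  (mY : forall t, (1 <= t)%N -> measurable_fun setT (Y t))
  (Y_in : forall t w, (1 <= t)%N -> Ydom (Y t w)).
Variable (thetastar : d.-tuple R).
Hypothesis Y_law : forall t, (1 <= t)%N ->
  is_cond_density P (history X Y t.-1) mu Ydom (Y t)
    (fun w => glm_density psi h (X t w) thetastar).
Variables (b m : R) (b_gt0 : 0 < b).
Hypotheses (X_bound : forall t, (1 <= t)%N ->
    {ae P, forall w, `|dotp thetastar (X t w)| <= b})
  (spsi : strongly_convex_on m b psi).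
Variable (q1 : probability (d.-tuple R) R).

(** The generating family of [history], named so that [TG t] can be the outcome space equipped with
    F_t; measurability on [TG t] then means being known at time t. *)
Definition history_generators t : set_system T :=
  [set A | (exists s, (1 <= s <= t.+1)%N /\
              preimage_set_system setT (X s) measurable A) \/
           (exists s, (1 <= s <= t)%N /\
              preimage_set_system setT (Y s) measurable A)].

Local Notation TG t := (g_sigma_algebraType (history_generators t)).

Lemma measurable_history_cov t s : (1 <= s <= t.+1)%N ->
  measurable_fun [set: TG t] (X s : TG t -> d.-tuple R).
Proof.
move=> st _ B mB; apply: sub_sigma_algebra; left; exists s; split => //.
by exists B.
Qed.

Lemma measurable_history_label t s : (1 <= s <= t)%N ->
  measurable_fun [set: TG t] (Y s : TG t -> R).
Proof.
move=> st _ B mB; apply: sub_sigma_algebra; right; exists s; split => //.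
by exists B.
Qed.

Lemma history_measurable t (A : set T) : history X Y t A -> measurable A.
Proof.
move: A; apply: smallest_sub; first exact: sigma_algebra_measurable.
move=> A [|] [s [/andP[s1 _]] [B mB <-]]; first exact: mX.
exact: mY.
Qed.

Local Open Scope ereal_scope.

Let mh : measurable_fun Ydom h := measurable_base_density p_density.

Local Notation M n w := (mix_prod psi h m b thetastar q1 (X ^~ w) (Y ^~ w) n).

Lemma measurable_history_mix_prod n k : (k <= n)%N ->
  measurable_fun [set: TG n] (fun w : TG n => M k w).
Proof.
move=> kn.
apply: (@measurable_mix_prod _ _ Ydom psi h m b thetastar q1 mYdom mh mpsi _
  (TG n) (X : nat -> TG n -> _) (Y : nat -> TG n -> _)) => //.
  move=> s /andP[s1 sk]; apply: measurable_history_cov.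
  by rewrite s1 (leq_trans sk)// leqW.
move=> s /andP[s1 sk]; apply: measurable_history_label.
by rewrite s1 (leq_trans sk).
Qed.

(** This is the event over which [ville_inequality] compares consecutive terms; being known at time
    n, it can test the supermartingale property. *)
Lemma history_mix_prod_le n (c : R) :
  history X Y n [set w | forall k, (k <= n)%N -> M k w <= c%:E].
Proof.
rewrite (_ : [set w | _] =
    \bigcap_(k in [set k | (k <= n)%N]) [set w | M k w <= c%:E]); last first.
  by apply/seteqP; split => w Bw k /=; exact: Bw.
apply: (@bigcap_measurable _ (TG n)); first by exists 0%N.
move=> k /= kn; rewrite -[X in measurable X]setTI.
apply: emeasurable_fun_infty_c => //; exact: measurable_history_mix_prod.
Qed.

(** Given F_n, the product so far, the covariate X_{n+1} and the mixture weights are fixed, while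
    Y_{n+1} has the density at [thetastar]; [integral_mixture_le1] then bounds the mean of the new
    gain by 1. *)
Lemma mix_prod_supermartingale n (A : set T) : history X Y n A ->
  \int[P]_(w in A) M n.+1 w <= \int[P]_(w in A) M n w.
Proof.
move=> GA; have mA := history_measurable GA.
(* The identity into [TG n] serves as the conditioning variable, carrying the whole history at
   once. *)
pose id_hist : T -> TG n := id.
have mid : measurable_fun setT id_hist.
  by move=> _ B mB; rewrite setTI; exact: (@history_measurable n B mB).
pose f (p : TG n * R) : R :=
  (glm_density psi h (X n.+1 p.1) thetastar \_ Ydom) p.2.
have f_ge0 p : (0 <= f p)%R.
  rewrite /f patchE; case: ifPn => // /set_mem yY.
  by have [_ + _] := p_density (X n.+1 p.1) thetastar; exact.
have mXn : measurable_fun [set: TG n] (X n.+1 : TG n -> _).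
  by apply: measurable_history_cov; rewrite leqnn.
have mf : measurable_fun setT f.
  apply: (@measurable_glm_density _ _ _ _ _ _ _ mYdom mh mpsi
    (fun p : TG n * R => X n.+1 p.1) snd (fun=> thetastar)) => //.
  exact: measurableT_comp.
have fE (A' : set (TG n)) (B : set R) : measurable A' -> measurable B ->
    P (id_hist @^-1` A' `&` Y n.+1 @^-1` B) =
    \int[P]_(w in id_hist @^-1` A') \int[mu]_(y in B) (f (id_hist w, y))%:E.
  move=> mA' mB; have [_ /(_ B mB)[_ ->//]] := Y_law (ltn0Sn n).
  apply: eq_integral => w _; rewrite setIC integral_mkcondr.
  apply: eq_integral => y _; rewrite /f !patchE.
  by case: ifP.
pose g (w : TG n) : \bar R := (\1_A w)%:E * M n w.
have g_ge0 w : 0 <= g w.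
  by rewrite mule_ge0 ?mix_prod_ge0// lee_fin.
have mg : measurable_fun setT g.
  apply: emeasurable_funM; last exact: measurable_history_mix_prod.
  by apply/measurable_EFinP/measurable_indicP.
pose W (p : TG n * R) :=
  mix_gain psi h m b thetastar q1 (X ^~ p.1) (Y ^~ p.1) n.+1 p.2.
have W_ge0 p : 0 <= W p by exact: mix_gain_ge0.
have mW : measurable_fun setT W.
  apply: (@measurable_mix_gain _ _ Ydom psi h m b thetastar q1 mYdom mh mpsi _
    (TG n) (X : nat -> TG n -> _) (Y : nat -> TG n -> _)) => //.
    by move=> s sn; exact: measurable_history_cov.
  by move=> s sn; exact: measurable_history_label.
pose F p := g p.1 * W p.
have F_ge0 p : 0 <= F p by rewrite mule_ge0.
have mF : measurable_fun setT F.
  by apply: emeasurable_funM => //; exact: measurableT_comp.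
have indE (k : T -> \bar R) :
    \int[P]_(w in A) k w = \int[P]_w ((\1_A w)%:E * k w).
  rewrite integral_mkcond; apply: eq_integral => w _.
  by rewrite patchE indicE; case: ifP => _; rewrite ?mul1e ?mul0e.
rewrite !indE.
have -> : \int[P]_w ((\1_A w)%:E * M n.+1 w) =
    \int[P]_w F (id_hist w, Y n.+1 w).
  by apply: eq_integral => w _; rewrite /F /g -muleA.
rewrite (integral_cond_density mid (mY (ltn0Sn n)) f_ge0 mf fE F_ge0 mF).
have mFf : measurable_fun setT (fun p : TG n * R => F p * (f p)%:E).
  by apply: emeasurable_funM => //; exact/measurable_EFinP.
have Ff_ge0 p : 0 <= F p * (f p)%:E by rewrite mule_ge0 ?lee_fin.
(* The comparison is only almost sure, as is the bound on the covariates. *)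
apply: ae_ge0_le_integral => //.
- by move=> w _; exact: integral_ge0.
- apply: (measurableT_comp (f := fun w : TG n =>
    \int[mu]_y (F (w, y) * (f (w, y))%:E)) (g := id_hist)) => //.
  exact: (measurable_fun_fubini_tonelli_F _ mFf Ff_ge0).
- by move=> w _; exact: g_ge0.
- exact: (measurableT_comp mg mid).
apply: filterS (X_bound (ltn0Sn n)) => w wb _.
rewrite -/(g w).
have -> : \int[mu]_y (F (id_hist w, y) * (f (id_hist w, y))%:E) =
    g w * \int[mu]_y (W (w, y) * (f (w, y))%:E).
  rewrite -ge0_integralZl//.
  - by apply: eq_integral => y _; rewrite /F muleA.
  - apply: emeasurable_funM.
      exact: (measurableT_comp mW (measurable_pair1 _)).
    apply/measurable_EFinP; exact: (measurableT_comp mf (measurable_pair1 _)).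
  - by move=> y _; rewrite mule_ge0 ?lee_fin.
rewrite -[leRHS]mule1 lee_wpmul2l// /W /f /mix_gain/=.
have mew : measurable_fun setT
    (ewa_weight 2^-1 (fun s => glm_loss psi h (X s w) (Y s w)) n.+1).
  apply: (@measurable_ewa_weight _ _ _ _ Ydom psi h mYdom mh mpsi _
    (fun s _ => X s w) (fun s _ => Y s w)) => // s theta.
  exact: Y_in.
apply: integral_mixture_le1 => //.
- by move=> theta; exact: ewa_density_ge0.
- exact: measurable_funM.
- exact: integral_ewa_density_le1.
Qed.

End supermartingale.

(** * Lower bound on the mixture product by regret and squared errors *)

Section gain_lower_bound.
Context (R : realType).

(* Jensen's inequality for z |-> exp (k (z - c)^2), read off its tangent. *)
Lemma expR_sqr_mean_le d0 (S : measurableType d0)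
    (nu : {measure set S -> \bar R}) (f : S -> R) (k c B : R) :
  nu setT = 1%E -> measurable_fun setT f -> (forall s, `|f s| <= B) -> 0 <= k ->
  ((expR (k * ((\int[nu]_s f s) - c) ^+ 2))%:E <=
   \int[nu]_s (expR (k * (f s - c) ^+ 2))%:E)%E.
Proof.
move=> nu1 mf fB k_ge0.
(* [al] and [be] are the value and the slope at the mean z of the function to be averaged; the
   tangent line has mean [al]. *)
set z := \int[nu]_s f s; pose al := expR (k * (z - c) ^+ 2).
pose be := al * (k * (2 * (z - c))).
have nufin : (nu setT < +oo)%E by rewrite nu1 ltry.
have B_ge0 : 0 <= B.
  have [[s _]|/set0P/negP/negPn/eqP T0] := pselect ([set: S] !=set0).
    exact: le_trans (fB s).
  by move/eqP: nu1; rewrite T0 measure0 eq_sym onee_eq0.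
have int_f : nu.-integrable setT (EFin \o f).
  apply: measurable_bounded_integrable => //.
  by exists B; split; [exact: num_real|move=> M BM s _; exact: le_trans (ltW BM)].
have int_cst (r : R) : nu.-integrable setT (EFin \o cst r).
  apply: measurable_bounded_integrable => //.
  by exists `|r|; split; [exact: num_real|move=> M hM s _; exact: ltW].
have int_d : nu.-integrable setT (EFin \o (fun s => f s - z)).
  exact: (integrableB measurableT int_f (int_cst z)).
have int_bd : nu.-integrable setT (EFin \o (fun s => be * (f s - z))).
  exact: (integrableZl measurableT be int_d).
have int_g : nu.-integrable setT (EFin \o (fun s => al + be * (f s - z))).
  exact: (integrableD measurableT (int_cst al) int_bd).
have int_phi : nu.-integrable setT (EFin \o (fun s => expR (k * (f s - c) ^+ 2))).
  apply: measurable_bounded_integrable => //.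
    apply: measurableT_comp => //; apply: measurable_funM => //.
    by apply: measurable_funX; exact: measurable_funB.
  exists (expR (k * (B + `|c|) ^+ 2)); split; first exact: num_real.
  move=> M hM s _; apply: le_trans (ltW hM) => /=.
  rewrite ger0_norm ?expR_ge0// ler_expR ler_wpM2l// -real_normK ?num_real//.
  rewrite lerXn2r ?nnegrE ?addr_ge0//.
  by apply: le_trans (ler_normB _ _) _; rewrite lerD2r.
have cstE (r : R) : \int[nu]_s r = r.
  by rewrite Rintegral_cst// nu1 mulr1.
have gE : \int[nu]_s (al + be * (f s - z)) = al.
  rewrite (RintegralD measurableT (int_cst al) int_bd).
  rewrite (RintegralZl be measurableT int_d).
  rewrite (RintegralB measurableT int_f (int_cst z)) /= !cstE.
  by rewrite -/z subrr mulr0 addr0.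
rewrite -/al -gE -[leRHS]fineK; last exact: integrable_fin_num int_phi.
rewrite lee_fin; apply: le_Rintegral => // s _.
have -> : k * (f s - c) ^+ 2 = k * (z - c) ^+ 2 + k * ((f s - c) ^+ 2 - (z - c) ^+ 2).
  by ring.
rewrite expRD -/al.
have al_ge0 : 0 <= al by exact: expR_ge0.
have -> : al + be * (f s - z) = al * (1 + k * (2 * (z - c) * (f s - z))).
  by rewrite /be; ring.
(* Uses [1 + v <= expR v] and then drops the square in (f s - c)^2 - (z - c)^2 = 2 (z - c) (f s - z)
   + (f s - z)^2. *)
rewrite ler_wpM2l//; apply: le_trans (expR_ge1Dx _).
by rewrite lerD2l ler_wpM2l//; have := sqr_ge0 (f s - z); nra.
Qed.

Lemma trunc_norm_le (b z : R) : 0 < b -> `|trunc b z| <= b.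
Proof. by move=> b0; rewrite ler_norml trunc_itv. Qed.

Context (d : nat).
Variables (Ydom : set R) (psi h : R -> R) (m b : R) (thetastar : d.-tuple R).
Variable (q1 : probability (d.-tuple R) R).
Hypotheses (mYdom : measurable Ydom) (mh : measurable_fun Ydom h)
  (mpsi : measurable_fun setT psi) (m_gt0 : 0 < m) (b_gt0 : 0 < b).
Variables (xs : nat -> d.-tuple R) (ys : nat -> R).
Hypothesis yY : forall s, (1 <= s)%N -> Ydom (ys s).
Variable q : nat -> {measure set (d.-tuple R) -> \bar R}.
Hypothesis q_prob : forall t, q t setT = 1%E.

Let ell s := glm_loss psi h (xs s) (ys s).
Hypothesis q_ewa : is_ewa 2^-1 q1 ell q.

Local Notation Z t := (ewa_normalizer 2^-1 q1 ell t).

Lemma ewa_weight1 theta : ewa_weight 2^-1 ell 1 theta = 1.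
Proof. by rewrite /ewa_weight big_geq// mulr0 oppr0 expR0. Qed.

Lemma ewa_normalizer1 : Z 1 = 1%E.
Proof.
rewrite /ewa_normalizer; under eq_integral do rewrite ewa_weight1.
by rewrite integral_cst// mul1e; exact: probability_setT.
Qed.

(** The first round fits the formula of the later ones, since the empty sum of losses gives weight
    and normalizer 1. *)
Lemma ewa_played t A : (1 <= t)%N -> measurable A ->
  q t A = (\int[q1]_(theta in A) (ewa_density q1 ell t theta)%:E)%E.
Proof.
case: t => [//|[|t]] _ mA; last by have [_ /(_ t.+2 isT)[_]] := q_ewa; exact.
rewrite q_ewa.1//; under eq_integral do
  rewrite /ewa_density ewa_weight1 ewa_normalizer1/= divr1.
by rewrite integral_cst// mul1e.
Qed.

Lemma ewa_normalizer_fin t : (1 <= t)%N -> Z t \is a fin_num.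
Proof.
move=> t1; rewrite ge0_fin_numE ?ewa_normalizer_ge0//.
case: t t1 => [//|[|t]] _; first by rewrite ewa_normalizer1 ltry.
by have [_ /(_ t.+2 isT)[]] := q_ewa.
Qed.

(* Otherwise the density of [q t], a probability, would be identically 0. *)
Lemma ewa_normalizer_gt0 t : (1 <= t)%N -> 0 < fine (Z t).
Proof.
move=> t1; rewrite lt_def fine_ge0 ?ewa_normalizer_ge0// andbT.
apply/eqP => Z0; have /eqP := q_prob t.
rewrite ewa_played// integral0_eq ?(eq_sym 0%E) ?onee_eq0//.
by move=> theta _; rewrite /ewa_density Z0 invr0 mulr0.
Qed.

Lemma measurable_ewa_weight_at t : measurable_fun setT (ewa_weight 2^-1 ell t).
Proof.
apply: (@measurable_ewa_weight _ _ _ _ Ydom psi h mYdom mh mpsi _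
  (fun s _ => xs s) (fun s _ => ys s)) => // s theta; exact: yY.
Qed.

Lemma ewa_weightS t theta : (1 <= t)%N ->
  ewa_weight 2^-1 ell t.+1 theta =
  ewa_weight 2^-1 ell t theta * expR (- (2^-1 * ell t theta)).
Proof.
by move=> t1; rewrite /ewa_weight big_nat_recr//= mulrDr opprD expRD.
Qed.

Lemma integral_ewa_played t (f : d.-tuple R -> \bar R) : (1 <= t)%N ->
  (forall theta, (0 <= f theta)%E) -> measurable_fun setT f ->
  (\int[q t]_theta f theta =
   \int[q1]_theta (f theta * (ewa_density q1 ell t theta)%:E))%E.
Proof.
move=> t1 f_ge0 mf; apply: ge0_integral_density => //.
- by move=> theta; exact: ewa_density_ge0.
- by apply: measurable_funM => //; exact: measurable_ewa_weight_at.
- by move=> A mA; exact: ewa_played.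
Qed.

Lemma measurable_ell t : (1 <= t)%N -> measurable_fun setT (ell t).
Proof.
move=> t1; apply: (@measurable_glm_loss _ _ _ _ Ydom psi h mYdom mh mpsi
  (fun=> xs t) (fun=> ys t) id) => // _; exact: yY.
Qed.

(** One more factor exp (- ell_t / 2) turns the weight at t into the weight at t+1, whose integral
    is the next normalizer. *)
Lemma integral_loss_ratio t : (1 <= t)%N ->
  (\int[q t]_theta (expR (- (2^-1 * ell t theta)))%:E =
   (fine (Z t.+1) / fine (Z t))%:E)%E.
Proof.
move=> t1; rewrite integral_ewa_played//; last first.
  apply/measurable_EFinP/measurableT_comp => //; apply: measurableT_comp => //.
  by apply: measurable_funM => //; exact: measurable_ell.
under eq_integral => theta _.
  rewrite -EFinM /ewa_density mulrA [_ * ewa_weight _ _ _ _]mulrC -ewa_weightS//.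
  rewrite EFinM; over.
rewrite ge0_integralZr//; last 3 first.
- by apply/measurable_EFinP; exact: measurable_ewa_weight_at.
- by move=> theta _; rewrite lee_fin expR_ge0.
- by rewrite lee_fin invr_ge0 ltW// ewa_normalizer_gt0.
by rewrite EFinM fineK// ewa_normalizer_fin.
Qed.

Lemma expR_scaled_log_loss t : (1 <= t)%N ->
  expR (- (scaled_log_loss 2^-1 (ell t) (q t) / 2)) = fine (Z t.+1) / fine (Z t).
Proof.
move=> t1; rewrite /scaled_log_loss /Rintegral integral_loss_ratio//= invrK.
set r := fine (Z t.+1) / _.
(* The logarithm is undone by the exponential only at positive arguments, hence the positivity of
   both normalizers. *)
have r_gt0 : 0 < r by apply: divr_gt0; exact: ewa_normalizer_gt0.
have -> : - (- (2 * ln r) / 2) = ln r by field.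
by rewrite lnK.
Qed.

Lemma mix_gain_lower_bound t : (1 <= t)%N ->
  ((expR (- ((scaled_log_loss 2^-1 (ell t) (q t) - ell t thetastar) / 2)
          + m / 8 * (dotp thetastar (xs t) -
                     trunc_prediction b (xs t) (q t.+1)) ^+ 2))%:E <=
   mix_gain psi h m b thetastar q1 xs ys t (ys t))%E.
Proof.
move=> t1; set c := dotp thetastar (xs t).
pose f theta := trunc b (dotp theta (xs t)).
have mf : measurable_fun setT f.
  by apply: measurable_trunc; exact: measurable_dotp.
pose g theta := expR (m / 8 * (f theta - c) ^+ 2).
have mg : measurable_fun setT g.
  apply: measurableT_comp => //; apply: measurable_funM => //.
  by apply: measurable_funX; exact: measurable_funB.
(* An exact identity: exp (- ell_t / 2) carries the density of [q t] to that of [q t.+1] up to the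
   ratio of normalizers. The only loss comes afterwards, from Jensen's inequality. *)
have -> : mix_gain psi h m b thetastar q1 xs ys t (ys t) =
    ((expR (ell t thetastar / 2) * (fine (Z t.+1) / fine (Z t)))%:E *
     \int[q t.+1]_theta (g theta)%:E)%E.
  rewrite integral_ewa_played//; last 2 first.
  - by move=> theta; rewrite lee_fin expR_ge0.
  - exact/measurable_EFinP.
  rewrite -ge0_integralZl//; last 3 first.
  - apply: emeasurable_funM; apply/measurable_EFinP => //.
    by apply: measurable_funM => //; exact: measurable_ewa_weight_at.
  - by move=> theta _; rewrite -EFinM lee_fin mulr_ge0 ?expR_ge0 ?ewa_density_ge0.
  - by rewrite lee_fin mulr_ge0 ?expR_ge0// divr_ge0 ?fine_ge0 ?ewa_normalizer_ge0.
  apply: eq_integral => theta _; rewrite -!EFinM; congr EFin.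
  rewrite -/ell /ewa_density ewa_weightS// /tilt -/c -/(f theta) expRD -/(g theta).
  have -> : expR (((dotp theta (xs t) - c) * ys t - psi (dotp theta (xs t)) +
      psi c) / 2) = expR (ell t thetastar / 2) * expR (- (2^-1 * ell t theta)).
    by rewrite -expRD /ell /glm_loss -/c; congr expR; field.
  by field; rewrite !gt_eqF ?ewa_normalizer_gt0.
have -> : - ((scaled_log_loss 2^-1 (ell t) (q t) - ell t thetastar) / 2) =
    ell t thetastar / 2 + - (scaled_log_loss 2^-1 (ell t) (q t) / 2) by field.
rewrite !expRD expR_scaled_log_loss// EFinM lee_wpmul2l//.
  by rewrite lee_fin mulr_ge0 ?expR_ge0// divr_ge0 ?fine_ge0 ?ewa_normalizer_ge0.
have -> : (c - trunc_prediction b (xs t) (q t.+1)) ^+ 2 =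
  (trunc_prediction b (xs t) (q t.+1) - c) ^+ 2 by ring.
apply: (@expR_sqr_mean_le _ _ _ f _ _ b) => //.
- by move=> theta; exact: trunc_norm_le.
- by rewrite divr_ge0// ltW.
Qed.

Lemma mix_prod_lower_bound n :
  ((expR (- (scaled_regret 2^-1 ell q n thetastar / 2)
          + m / 8 * \sum_(1 <= t < n.+1) (dotp thetastar (xs t) -
                     trunc_prediction b (xs t) (q t.+1)) ^+ 2))%:E <=
   mix_prod psi h m b thetastar q1 xs ys n)%E.
Proof.
elim: n => [|n ih] /=.
  by rewrite /scaled_regret !big_geq// mul0r oppr0 mulr0 addr0 expR0.
rewrite /scaled_regret !(big_nat_recr n.+1)//= -/(scaled_regret _ _ _ _ _).
set r := scaled_regret _ _ _ _ _; set s := \sum_(_ <= _ < _) _.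
set l := (X in - ((r + X) / 2)); set v := _ ^+ 2.
have -> : - ((r + l) / 2) + m / 8 * (s + v) =
    (- (r / 2) + m / 8 * s) + (- (l / 2) + m / 8 * v) by field.
rewrite expRD EFinM lee_pmul ?lee_fin ?expR_ge0//.
exact: mix_gain_lower_bound.
Qed.

End gain_lower_bound.

(** * Measurability of the failure event and the coverage bound *)

(** Positive and negative parts reduce this to nonnegative integrands, and [fine] of their
    difference is measurable even where it is infinite. It shows that losses and predictions depend
    measurably on the outcome. *)
Lemma measurable_Rintegral_kernel d d' (S : measurableType d)
    (S' : measurableType d') (R : realType) (l : R.-fker S ~> S')
    (f : S * S' -> R) : measurable_fun setT f ->
  measurable_fun setT (fun w => \int[l w]_s f (w, s)).
Proof.
move=> mf; have mfe : measurable_fun setT (EFin \o f) by exact/measurable_EFinP.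
apply: (measurableT_comp (fine_measurable measurableT)).
under eq_fun do rewrite integralE.
apply: emeasurable_funB.
- rewrite (_ : (fun _ => _) =
      fun w => (\int[l w]_s ((EFin \o f)^\+ (w, s)))%E); last first.
    by apply/funext => w; apply: eq_integral => s _; rewrite !funeposE.
  apply: measurable_fun_integral_finite_kernel; last exact: measurable_funepos.
  by move=> z; exact: funepos_ge0.
- rewrite (_ : (fun _ => _) =
      fun w => (\int[l w]_s ((EFin \o f)^\- (w, s)))%E); last first.
    by apply/funext => w; apply: eq_integral => s _; rewrite !funenegE.
  apply: measurable_fun_integral_finite_kernel; last exact: measurable_funeneg.
  by move=> z; exact: funeneg_ge0.
Qed.

Theorem theorem4p6 (R : realType) (dT : measure_display)
    (T : measurableType dT) (P : probability T R)
    (d : nat) (d_ge1 : (1 <= d)%N)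
    (* the label space, its reference measure, and the model *)
    (Ydom : set R) (mYdom : measurable Ydom)
    (mu : {sigma_finite_measure set R -> \bar R})
    (h : R -> R) (h_ge0 : forall y, Ydom y -> 0 <= h y)
    (psi : R -> R) (psi_convex : convex_function [set: R^o] psi)
    (psi_diff : forall z : R, derivable psi z 1)
    (p_density : forall x theta : d.-tuple R,
       is_density mu Ydom (glm_density psi h x theta))
    (M : R) (M_gt0 : 0 < M) (psi_smooth : smooth M psi)
    (* the data *)
    (X : nat -> T -> d.-tuple R) (Y : nat -> T -> R)
    (mX : forall t, (1 <= t)%N -> measurable_fun setT (X t))
    (mY : forall t, (1 <= t)%N -> measurable_fun setT (Y t))
    (Y_in : forall t w, (1 <= t)%N -> Ydom (Y t w))
    (thetastar : d.-tuple R)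
    (Y_law : forall t, (1 <= t)%N ->
       is_cond_density P (history X Y t.-1) mu Ydom (Y t)
         (fun w => glm_density psi h (X t w) thetastar))
    (* the bound and the strong convexity *)
    (b : R) (b_gt0 : 0 < b)
    (X_bound : forall t, (1 <= t)%N ->
       {ae P, forall w, `|dotp thetastar (X t w)| <= b})
    (m : R) (m_gt0 : 0 < m) (psi_strong : strongly_convex_on m b psi)
    (* the forecaster *)
    (Theta : set (d.-tuple R)) (mTheta : measurable Theta)
    (q1 : probability (d.-tuple R) R) (q1_Theta : q1 Theta = 1%E)
    (q : nat -> R.-pker T ~> (d.-tuple R))
    (q_ewa : {ae P, forall w,
       is_ewa 2^-1 q1 (fun t => glm_loss psi h (X t w) (Y t w))
         (fun t => q t w)})
    (delta : R) (delta_gt0 : 0 < delta) (delta_lt1 : delta < 1) :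
  (P [set w | exists n : nat, (1 <= n)%N /\
       ~ confidence_set m delta b (fun t => X t w)
           (fun t => glm_loss psi h (X t w) (Y t w)) (fun t => q t w)
           thetastar n thetastar] <= delta%:E)%E.
Proof.
have dpsi : twice_differentiable psi by case: psi_smooth.
have mpsi : measurable_fun setT psi.
  apply: continuous_measurable_fun => z.
  by apply: differentiable_continuous; exact/derivable1_diffP.
have mh : measurable_fun Ydom h by exact: measurable_base_density p_density.
pose ell w t := glm_loss psi h (X t w) (Y t w).
pose V n w := mix_prod psi h m b thetastar q1 (X ^~ w) (Y ^~ w) n.
have mV n : measurable_fun setT (V n).
  apply: (@measurable_mix_prod _ _ Ydom psi h m b thetastar q1 mYdom mh mpsi) => //.
    by move=> s /andP[s1 _]; exact: mX.
  by move=> s /andP[s1 _]; exact: mY.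
have V_ville : (P [set w | exists n, (delta^-1)%:E < V n w] <= delta%:E)%E.
  (* Ville's inequality bounds the probability by the inverse of its threshold, here [delta^-1]. *)
  rewrite -[leRHS]/(delta%:E) -[delta in leRHS]invrK.
  apply: ville_inequality => //.
  - by rewrite invr_gt0.
  - by move=> n w; exact: mix_prod_ge0.
  move=> n; apply: (@mix_prod_supermartingale _ _ _ _ _ Ydom mYdom mu) => //.
  exact: (@history_mix_prod_le _ _ _ _ Ydom).
have mloss t theta : (1 <= t)%N -> measurable_fun setT theta ->
    measurable_fun setT (fun p : T * d.-tuple R => ell p.1 t (theta p)).
  move=> t1 mtheta; apply: (@measurable_glm_loss _ _ _ _ Ydom psi h mYdom mh mpsi
    (fun p : T * d.-tuple R => X t p.1) (fun p => Y t p.1) theta) => //.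
  - by apply: measurableT_comp => //; exact: mX.
  - by apply: measurableT_comp => //; exact: mY.
  - by move=> p; exact: Y_in.
have mell t : (1 <= t)%N -> measurable_fun setT (fun w => ell w t thetastar).
  move=> t1; apply: (measurableT_comp (mloss t (fun=> thetastar) t1 _)
    (g := fun w => (w, thetastar))) => //.
have mdot t : (1 <= t)%N ->
    measurable_fun setT (fun p : T * d.-tuple R => dotp p.2 (X t p.1)).
  move=> t1; apply: measurable_dotp => //.
  by apply: measurableT_comp => //; exact: mX.
have mlogloss t : (1 <= t)%N ->
    measurable_fun setT (fun w => scaled_log_loss 2^-1 (ell w t) (q t w)).
  move=> t1; apply: measurableT_comp => //; apply: measurable_funM => //.
  apply: measurableT_comp => //.
  apply: (@measurable_Rintegral_kernel _ _ _ _ _ (q t)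
    (fun p => expR (- (2^-1 * ell p.1 t p.2)))).
  apply: measurableT_comp => //; apply: measurableT_comp => //.
  by apply: measurable_funM => //; exact: mloss.
have mpred t : (1 <= t)%N ->
    measurable_fun setT (fun w => trunc_prediction b (X t w) (q t.+1 w)).
  move=> t1; apply: (@measurable_Rintegral_kernel _ _ _ _ _ (q t.+1)
    (fun p => trunc b (dotp p.2 (X t p.1)))).
  by apply: measurable_trunc; exact: mdot.
have mbeta n : measurable_fun setT
    (fun w => beta_radius m delta (ell w) (fun t => q t w) thetastar n).
  apply: measurable_funD => //; apply: measurable_funM => //.
  (* Shifting the index makes every time in the sum positive, as the measurability facts require. *)
  rewrite /scaled_regret; under eq_fun do rewrite big_add1.
  apply: measurable_sum => t; apply: measurable_funB; last exact: mell.
  exact: mlogloss.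
have mdev n : measurable_fun setT (fun w => 2^-1 * \sum_(1 <= t < n.+1)
    (dotp thetastar (X t w) - trunc_prediction b (X t w) (q t.+1 w)) ^+ 2).
  apply: measurable_funM => //; under eq_fun do rewrite big_add1.
  apply: measurable_sum => t; apply: measurable_funX; apply: measurable_funB.
    by apply: measurable_dotp => //; exact: mX.
  exact: mpred.
(* Needed because [P] is unconstrained on nonmeasurable sets. *)
set bad := [set w | _].
have mbad : measurable bad.
  rewrite (_ : bad = \bigcup_(n in [set n | (1 <= n)%N])
    [set w | beta_radius m delta (ell w) (fun t => q t w) thetastar n <
       2^-1 * \sum_(1 <= t < n.+1)
    (dotp thetastar (X t w) - trunc_prediction b (X t w) (q t.+1 w)) ^+ 2]).
    apply: bigcup_measurable => n _; rewrite -[X in measurable X]setTI.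
    have mtrue : measurable [set true] by [].
    exact: (measurable_fun_ltr (mbeta n) (mdev n) measurableT mtrue).
  apply/seteqP; split => w.
    by move=> [n [n1 /negP]]; rewrite -ltNge => ?; exists n.
  move=> [n n1 nw]; exists n; split => //=; apply/negP.
  by rewrite -ltNge.
have mVgt : measurable [set w | exists n, ((delta^-1)%:E < V n w)%E].
  rewrite (_ : [set w | _] = \bigcup_n [set w | ((delta^-1)%:E < V n w)%E]).
    apply: bigcupT_measurable => n; rewrite -[X in measurable X]setTI.
    exact: emeasurable_fun_o_infty.
  by apply/seteqP; split => w [n]; [exists n|move=> _ ?; exists n].
(* The null set [N] contains the outcomes on which [q] is not the forecaster; outside it, a failure
   of coverage forces some [V n] above [delta^-1]. *)
have [N [mN PN0 ewaN]] := q_ewa.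
apply: le_trans V_ville.
apply: (@le_trans _ _ (P ([set w | exists n, ((delta^-1)%:E < V n w)%E] `|` N))).
  apply: le_measure; rewrite ?inE//; first exact: measurableU.
  move=> w bw; have [Nw|Nw] := pselect (N w); [by right|left].
  have ewa_w : is_ewa 2^-1 q1 (ell w) (fun t => q t w).
    by apply: contrapT => /(ewaN w).
  move: bw => [n [n1 /negP]]; rewrite -ltNge => bn; exists n.
  have q_prob t : q t w setT = 1%E by exact: prob_kernel.
  have yY s : (1 <= s)%N -> Ydom (Y s w) by exact: Y_in.
  have := @mix_prod_lower_bound _ _ Ydom psi h m b thetastar q1 mYdom mh mpsi
    m_gt0 b_gt0 (X ^~ w) (Y ^~ w) yY (fun t => q t w) q_prob ewa_w n.
  apply: lt_le_trans; rewrite lte_fin.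
  rewrite -[ltLHS](@lnK _ (delta^-1)) ?posrE ?invr_gt0// ltr_expR.
  move: bn; rewrite /beta_radius -/(ell w).
  set r := scaled_regret _ _ _ _ _; set s := \sum_(_ <= _ < _) _.
  set l := ln _ => bn.
  (* The radius times m / 4 equals [r / 2 + l], so the violated bound times m / 4 puts [l] below the
     exponent of the lower bound on [V n]. *)
  have -> : l = m / 4 * (2 / m * r + 4 / m * l) - r / 2.
    by field; rewrite gt_eqF.
  have -> : - (r / 2) + m / 8 * s = m / 4 * (2^-1 * s) - r / 2 by field.
  by rewrite ltrD2r ltr_pM2l// divr_gt0.
apply: le_trans (measureU2 _ mVgt mN) _.
by rewrite [X in (_ + X <= _)%E]PN0 adde0.
Qed.
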